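(* Let $|\psi\rangle\in\mathcal H_n$ be a normalized $n$-fermion state on $m$ modes and let $|G\rangle\in\mathcal S$ be a Slater determinant. Let $\alpha=|\langle G|\psi\rangle|$, $\kappa=\alpha-\sqrt2\sqrt{1-\alpha^2}$, and let $B_G$ be the Brillouin residual $B_G=\sqrt{\sum_{a,\mu}|\langle G_{a\mu}|\psi\rangle|^2}$. Suppose $$|\langle G|\psi\rangle|^2>2/3,$$ and let $\mathsf{OPT}=\max_{|S\rangle\in\mathcal S}|\langle S|\psi\rangle|^2$. Then $$\mathsf{OPT}\ \le\ \left(|\langle G|\psi\rangle|+\frac{B_G^2}{2\kappa}\right)^2 .$$ In particular, if $B_G=0$ then $|G\rangle$ is the unique globally closest Slater determinant to $|\psi\rangle$ (i.e. the unique maximizer of $|\langle S|\psi\rangle|^2$ over $|S\rangle\in\mathcal S$), up to phase.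
   Context: $\mathcal H_1$ is an $m$-dimensional complex Hilbert space, $n\le m$, $\mathcal H_n=\wedge^n\mathcal H_1$, and $\mathcal S=\{|\varphi_1\rangle\wedge\cdots\wedge|\varphi_n\rangle:\langle\varphi_i|\varphi_j\rangle=\delta_{ij}\}\subset\mathcal H_n$ is the set of (unit-norm) Slater determinants. For a Slater determinant $|G\rangle=c_{g_1}^\dagger\cdots c_{g_n}^\dagger|0\rangle$ with orthonormal occupied orbitals $g_1,\dots,g_n$, let $f_1,\dots,f_{m-n}$ be an orthonormal basis of the orthogonal complement of $\operatorname{span}\{g_\mu\}$ in $\mathcal H_1$ (unoccupied orbitals); here $c_v^\dagger$ denotes the fermionic creation operator of orbital $v$ and $c_v$ its adjoint. The single particle-hole excitations are $|G_{a\mu}\rangle=c_{f_a}^\dagger c_{g_\mu}|G\rangle$, $1\le a\le m-n$, $1\le\mu\le n$. Note $\alpha^2>2/3$ if and only if $\kappa>0$. *)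

(* Defs.v *)
From mathcomp Require Import all_boot all_order all_algebra.
From mathcomp Require Import complex.
From mathcomp Require Import all_classical all_reals all_analysis.

Set Implicit Arguments.
Unset Strict Implicit.
Unset Printing Implicit Defensive.

Import Order.TTheory GRing.Theory Num.Theory.
Import numFieldNormedType.Exports.
Local Open Scope classical_set_scope.
Local Open Scope sesquilinear_scope.
Local Open Scope ring_scope.
Local Open Scope complex_scope.

(* The exterior algebra of the one-particle space 'rV[R[i]]_m (with its
   standard Hermitian product) in the orthonormal basis e_I, where
   I = {i_1 < ... < i_k} and e_I = e_{i_1} /\ ... /\ e_{i_k}: the value x I is
   the coordinate of x along e_I.  *)
Notation fock R m := {ffun {set 'I_m} -> R[i]}.

(* A finite orthonormal family of orbitals is the family of rows of a matrix
   M with M *m M^t* = 1%:M, i.e. of an M \is unitarymx, not necessarily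
   square. *)
Notation orbitals R k m := 'M[R[i]]_(k, m).

Section Fock.
Variables (R : realType) (m : nat).
Local Notation C := (R[i]).
Implicit Types (x y : fock R m) (v : 'rV[C]_m) (I : {set 'I_m}).

Definition ket I : fock R m := [ffun J => (J == I)%:R].

Definition vacuum : fock R m := ket finset.set0.

(* The n-th exterior power, as a subspace of the exterior algebra. *)
Definition sector (n : nat) : set (fock R m) :=
  [set x | forall I, #|I| != n -> x I = 0].

(* Conjugate-linear in the first argument. *)
Definition fdot x y : C := \sum_(I : {set 'I_m}) (x I)^*%R * y I.

(* The creation operator x |-> v /\ x, from
   e_i /\ e_J = (-1)^#{j in J | j < i} e_(i |: J) if i is not in J, and 0
   otherwise. *)
Definition creation v x : fock R m :=
  [ffun I : {set 'I_m} => \sum_(i in I)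
     (-1) ^+ #|[set j in I | (j < i)%N]%SET| * v 0 i * x (I :\ i)%SET].

(* The adjoint of [creation v], defined by its coordinates in the basis e_I;
   see [annihilation_adjoint]. *)
Definition annihilation v x : fock R m :=
  [ffun I => fdot (creation v (ket I)) x].

(* phi_1 /\ ... /\ phi_n = c^+_{phi_1} ... c^+_{phi_n} |0> *)
Definition wedge n (phi : orbitals R n m) : fock R m :=
  foldr (fun mu x => creation (row mu phi) x) vacuum (enum 'I_n).

Definition slater (n : nat) : set (fock R m) :=
  [set S | exists2 phi : orbitals R n m, phi \is unitarymx & S = wedge phi].

(* |<x|y>|, as an element of R rather than of R[i] *)
Definition overlap x y : R := complex.Re `|fdot x y|.

Definition excitation n k (g : orbitals R n m) (f : orbitals R k m)
    (a : 'I_k) (mu : 'I_n) : fock R m :=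
  creation (row a f) (annihilation (row mu g) (wedge g)).

Definition brillouin n k (g : orbitals R n m) (f : orbitals R k m)
    (psi : fock R m) : R :=
  Num.sqrt (\sum_(a < k) \sum_(mu < n) overlap (excitation g f a mu) psi ^+ 2).

(* The rows of f are an orthonormal basis of the orthogonal complement of the
   span of the rows of g. *)
Definition onb_complement n k (g : orbitals R n m) (f : orbitals R k m) : Prop :=
  f \is unitarymx /\
  (f :=: orthomx Num.conj (mx_of_hermitian (hermitian1mx _)) g)%MS.

Definition is_max (A : set R) (x : R) : Prop := A x /\ ubound A x.

(* The values of which OPT is the maximum; that maximum exists by
   [OPT_exists]. *)
Definition fidelities (n : nat) (psi : fock R m) : set R :=
  [set overlap S psi ^+ 2 | S in slater n].

Definition closest_slater (n : nat) (psi S : fock R m) : Prop :=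
  slater n S /\
  forall S', slater n S' -> overlap S' psi ^+ 2 <= overlap S psi ^+ 2.

Lemma ket_sum x : x = \sum_I x I *: ket I.
Proof.
apply/ffunP => J; rewrite sum_ffunE (bigD1 J) //= !ffunE eqxx [LHS]/= big1.
  by rewrite addr0 /GRing.scale /= mulr1.
by move=> I nI; rewrite !ffunE eq_sym (negPf nI) /GRing.scale /= mulr0.
Qed.

Lemma creation_sum v x I :
  creation v x I = \sum_J x J * creation v (ket J) I.
Proof.
under eq_bigr do rewrite ffunE mulr_sumr.
rewrite ffunE exchange_big /=; apply: eq_bigr => i iI.
rewrite (bigD1 (I :\ i)%SET) //= ffunE eqxx mulr1 mulrC big1 ?addr0 //.
by move=> J nJ; rewrite ffunE eq_sym (negPf nJ) !mulr0.
Qed.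

Lemma annihilation_adjoint v x y :
  fdot (creation v x) y = fdot x (annihilation v y).
Proof.
rewrite /fdot; under [RHS]eq_bigr do rewrite ffunE mulr_sumr.
rewrite exchange_big /=; apply: eq_bigr => I _.
rewrite creation_sum rmorph_sum /= mulr_suml; apply: eq_bigr => J _.
by rewrite rmorphM mulrA.
Qed.

Lemma creation_sector n v x : sector n x -> sector n.+1 (creation v x).
Proof.
move=> xn I In; rewrite ffunE big1 // => i iI; rewrite xn ?mulr0 //.
by apply: contraNneq In => <-; rewrite (cardsD1 i I) iI.
Qed.

Lemma wedge_sector n (phi : orbitals R n m) : sector n (wedge phi).
Proof.
rewrite /wedge -[X in sector X](size_enum_ord n).
elim: (enum 'I_n) => [|mu s IH] /=; last exact: creation_sector.
by move=> I; rewrite cards_eq0 ffunE => /negPf ->.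
Qed.

End Fock.

Section OPT.
Variables (R : realType) (m n : nat).
Local Notation C := (R[i]).
Local Notation N := (n * m + n * m)%N.
Local Notation T := ('rV[R]_N).

Let ccont (f : T -> C) :=
  continuous (fun v => complex.Re (f v)) /\
  continuous (fun v => complex.Im (f v)).

Let eq_cont (f g : T -> R) : f =1 g -> continuous f -> continuous g.
Proof. by move=> /funext ->. Qed.

Let eq_ccont (f g : T -> C) : f =1 g -> ccont f -> ccont g.
Proof. by move=> /funext ->. Qed.

Let contD (U : topologicalType) (f g : U -> R) :
  continuous f -> continuous g -> continuous (fun v => f v + g v).
Proof. by move=> cf cg v; apply: cvgD; [exact: cf|exact: cg]. Qed.

Let contM (U : topologicalType) (f g : U -> R) :
  continuous f -> continuous g -> continuous (fun v => f v * g v).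
Proof. by move=> cf cg v; apply: cvgM; [exact: cf|exact: cg]. Qed.

Let contN (U : topologicalType) (f : U -> R) : continuous f -> continuous (fun v => - f v).
Proof. by move=> cf v; apply: cvgN; exact: cf. Qed.

Let ccont_cst c : ccont (fun=> c).
Proof. by split=> v; exact: cst_continuous. Qed.

Let ccontD f g : ccont f -> ccont g -> ccont (fun v => f v + g v).
Proof.
move=> [fr fi] [gr gi]; split.
  by apply: eq_cont (contD fr gr) => v; case: (f v) (g v) => [? ?] [? ?].
by apply: eq_cont (contD fi gi) => v; case: (f v) (g v) => [? ?] [? ?].
Qed.

Let ccontM f g : ccont f -> ccont g -> ccont (fun v => f v * g v).
Proof.
move=> [fr fi] [gr gi]; split.
  apply: eq_cont (contD (contM fr gr) (contN (contM fi gi))) => v.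
  by case: (f v) (g v) => [? ?] [? ?].
apply: eq_cont (contD (contM fr gi) (contM fi gr)) => v.
by case: (f v) (g v) => [? ?] [? ?].
Qed.

Let ccontJ f : ccont f -> ccont (fun v => (f v)^*%R).
Proof.
move=> [fr fi]; split; first by apply: eq_cont fr => v; case: (f v).
by apply: eq_cont (contN fi) => v; case: (f v).
Qed.

Let ccont_sum (K : Type) (s : seq K) (P : pred K) (F : K -> T -> C) :
  (forall k, ccont (F k)) -> ccont (fun v => \sum_(k <- s | P k) F k v).
Proof.
move=> cF; elim: s => [|k s IH].
  by apply: eq_ccont (ccont_cst 0) => v; rewrite big_nil.
have [Pk|nPk] := boolP (P k).
  by apply: eq_ccont (ccontD (cF k) IH) => v; rewrite big_cons Pk.
by apply: eq_ccont IH => v; rewrite big_cons (negPf nPk).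
Qed.

Let dec (v : T) : orbitals R n m := \matrix_(i, j)
  (v 0 (lshift _ (mxvec_index i j)) +i* v 0 (rshift _ (mxvec_index i j))).

Let enc (M : orbitals R n m) : T :=
  row_mx (mxvec (\matrix_(i, j) complex.Re (M i j)))
         (mxvec (\matrix_(i, j) complex.Im (M i j))).

Let encK M : dec (enc M) = M.
Proof.
apply/matrixP => i j; rewrite mxE row_mxEl row_mxEr !mxvecE !mxE.
by case: (M i j).
Qed.

Let ccont_dec i j : ccont (fun v => dec v i j).
Proof.
split.
  apply: eq_cont (@coord_continuous _ _ _ 0 (lshift _ (mxvec_index i j))) => v.
  by rewrite mxE.
apply: eq_cont (@coord_continuous _ _ _ 0 (rshift _ (mxvec_index i j))) => v.
by rewrite mxE.
Qed.

Let ccont_wedge I : ccont (fun v => wedge (dec v) I).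
Proof.
rewrite /wedge; elim: (enum 'I_n) I => [|mu s IH] I /=; first exact: ccont_cst.
apply: (@eq_ccont (fun v => \sum_(i in I)
    (-1) ^+ #|[set j in I | (j < i)%N]%SET| * dec v mu i *
    foldr (fun mu x => creation (row mu (dec v)) x) (vacuum R m) s
      (I :\ i)%SET)) => [v|].
  by rewrite ffunE; apply: eq_bigr => i _; rewrite [row _ _ _ _]mxE.
apply: ccont_sum => i; apply: ccontM; last exact: IH.
by apply: ccontM; [exact: ccont_cst|exact: ccont_dec].
Qed.

Let sq_overlapE (x y : fock R m) : overlap x y ^+ 2 =
  complex.Re (fdot x y) ^+ 2 + complex.Im (fdot x y) ^+ 2.
Proof.
by rewrite /overlap normc_def /= sqr_sqrtr // addr_ge0 // sqr_ge0.
Qed.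

Let cont_overlap psi : continuous (fun v => overlap (wedge (dec v)) psi ^+ 2).
Proof.
have [cr ci] : ccont (fun v => fdot (wedge (dec v)) psi).
  apply: ccont_sum => I; apply: ccontM; last exact: ccont_cst.
  by apply: ccontJ; exact: ccont_wedge.
by apply: eq_cont (contD (contM cr cr) (contM ci ci)) => v; rewrite sq_overlapE.
Qed.

Let unit_set : set T := [set v | dec v \is unitarymx].

Let closed_unit : closed unit_set.
Proof.
pose F i j v := (dec v *m (dec v)^t Num.conj) i j.
have cF i j : ccont (F i j).
  apply: (@eq_ccont (fun v => \sum_k dec v i k * (dec v j k)^*%R)) => [v|].
    by rewrite /F mxE; apply: eq_bigr => k _; rewrite !mxE.
  apply: ccont_sum => k; apply: ccontM; first exact: ccont_dec.
  by apply: ccontJ; exact: ccont_dec.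
have closed_lvl (f : T -> R) c : continuous f -> closed [set v | f v = c].
  move=> cf; apply: (@preimage_closed _ _ f [set x | x = c]).
    by move=> v _; exact: cf.
  exact: closed_eq.
have -> : unit_set = \bigcap_(ij in [set: 'I_n * 'I_n])
    ([set v | complex.Re (F ij.1 ij.2 v) = complex.Re ((ij.1 == ij.2)%:R : C)]
     `&` [set v | complex.Im (F ij.1 ij.2 v) =
           complex.Im ((ij.1 == ij.2)%:R : C)]).
  apply/seteqP; split=> v.
    by move=> /unitarymxP uv [i j] _; rewrite /= /F uv mxE.
  move=> h; apply/unitarymxP/matrixP => i j.
  rewrite [RHS]mxE -/(F i j v); have [] := h (i, j) Logic.I => /=.
  by case: (F i j v) ((i == j)%:R) => [a b] [c d] /= -> ->.
by apply: closed_bigI => -[i j] _ /=; apply: closedI; apply: closed_lvl;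
  [exact: (cF i j).1|exact: (cF i j).2].
Qed.

Let bounded_unit : bounded_set unit_set.
Proof.
exists 1; split=> // M M1 v /unitarymxP uv; apply: le_trans (ltW M1).
rewrite [leLHS]/Num.norm /= mx_normrE; apply/bigmax_leP; split=> //= -[i' k] _ /=.
rewrite ord1.
suff le1 i j : complex.Re (dec v i j) ^+ 2 + complex.Im (dec v i j) ^+ 2 <= 1.
  have sqr1 (x y : R) : x ^+ 2 + y ^+ 2 <= 1 -> `|x| <= 1.
    move=> xy; rewrite -(@ler_sqr R) ?nnegrE // real_normK ?num_real // expr1n.
    by apply: le_trans xy; rewrite lerDl sqr_ge0.
  case: (split_ordP k) => l ->; case/mxvec_indexP: l => i j; have := le1 i j.
    by rewrite mxE /=; exact: sqr1.
  by rewrite mxE /= addrC; exact: sqr1.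
have := congr1 (@complex.Re R) (congr1 (fun M : 'M[C]_n => M i i) uv).
rewrite !mxE eqxx /= => <-; rewrite raddf_sum (bigD1 j) //= !mxE.
have e (z : C) : complex.Re (z * z^*%R) = complex.Re z ^+ 2 + complex.Im z ^+ 2.
  by case: z => a b /=; rewrite mulrN opprK -!expr2.
rewrite e /= lerDl sumr_ge0 // => l _.
by rewrite !mxE e addr_ge0 // sqr_ge0.
Qed.

Lemma OPT_exists (psi : fock R m) :
  (n <= m)%N -> exists OPT, is_max (fidelities n psi) OPT.
Proof.
move=> nm; have ne : unit_set !=set0.
  exists (enc (pid_mx n)); rewrite /unit_set /= encK; apply/unitarymxP.
  apply/matrixP => i j; rewrite !mxE (bigD1 (widen_ord nm i)) //= !mxE /=.
  rewrite eqxx ltn_ord /= mul1r big1 ?addr0 => [|k ki].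
    by rewrite (ltn_ord j) andbT rmorph_nat eq_sym.
  rewrite !mxE (_ : (i == k :> nat) = false) ?mul0r //.
  by apply: contraNF ki => /eqP ik; apply/eqP/val_inj; rewrite /= ik.
have [] := compact_EVT_max ne
  (bounded_closed_compact bounded_unit closed_unit)
  (continuous_subspaceT (cont_overlap (psi := psi))).
move=> v /set_mem uv vmax; exists (overlap (wedge (dec v)) psi ^+ 2); split.
  by exists (wedge (dec v)) => //; exists (dec v).
move=> _ [_ [phi uphi ->] <-]; rewrite -[phi]encK; apply: vmax.
by apply/mem_set; rewrite /unit_set /= encK.
Qed.

End OPT.

(* Main.v *)
Require Import Defs.
From mathcomp Require Import all_boot all_order all_algebra.
From mathcomp Require Import complex.
From mathcomp Require Import all_classical all_reals all_analysis.
From mathcomp Require Import ring lra zify.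

Import Order.TTheory GRing.Theory Num.Theory.
Local Open Scope sesquilinear_scope.
Local Open Scope complex_scope.
Local Open Scope ring_scope.

(* Let S be a Slater determinant, c = |<G|S>|, and let t and u be the vectors of
   |<G_{a mu}|S>| and of |<G_{a mu}|psi>|. The states G and G_{a mu} are
   orthonormal, so splitting S and psi along them and applying Cauchy-Schwarz
   to the remainders gives
     |<S|psi>| <= c alpha + t.u
                  + sqrt (1 - c^2 - |t|^2) sqrt (1 - alpha^2 - |u|^2),
   where |u| = B_G. What is special to Slater determinants is
     1 - c^2 - |t|^2 <= 2 (1 - c)^2.                                     (1)
   Granted this, t.u <= |u|^2 / (2 kappa) + kappa |t|^2 / 2 and
   |t|^2 <= 1 - c^2 yield
     |<S|psi>| + kappa (1 - c)^2 / 2 <= alpha + B_G^2 / (2 kappa),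
   which is the bound on OPT and forces c = 1 if B_G = 0 and S is optimal.

   For (1), let A and B be the matrices of inner products of the orbitals of S
   with the g_mu and with the f_a. Then c = |det A| and |t| is the Frobenius
   norm of adj(A) B. As A A^H + B B^H = 1, for invertible A the matrix
   T = A^{-1} B satisfies det (1 + T T^H) = c^{-2} and |t|^2 = c^2 tr (T T^H).
   In terms of the numbers s_i >= 1 such that the s_i^2 are the eigenvalues of
   1 + T T^H, (1) reads (D - 1) (3 - D) <= sum_i (s_i^2 - 1), D = prod_i s_i. *)

(** * The Hermitian form on Fock space, Cauchy-Schwarz and Bessel *)

Section FockForm.
Variables (R : realType) (m : nat).
Local Notation C := (R[i]).
Implicit Types (x y z : fock R m) (v w : 'rV[C]_m) (I : {set 'I_m}).

Lemma fdotDr x y z : fdot x (y + z) = fdot x y + fdot x z.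
Proof. by rewrite -big_split; apply: eq_bigr => I _; rewrite ffunE mulrDr. Qed.

Lemma fdotZr c x y : fdot x (c *: y) = c * fdot x y.
Proof.
by rewrite mulr_sumr; apply: eq_bigr => I _; rewrite ffunE mulrCA.
Qed.

Lemma fdotC x y : fdot y x = (fdot x y)^*.
Proof.
rewrite /fdot rmorph_sum; apply: eq_bigr => I _.
by rewrite rmorphM /= conjCK mulrC.
Qed.

Lemma fdotNr x y : fdot x (- y) = - fdot x y.
Proof. by rewrite -scaleN1r fdotZr mulN1r. Qed.

Lemma fdotBr x y z : fdot x (y - z) = fdot x y - fdot x z.
Proof. by rewrite fdotDr fdotNr. Qed.

Lemma fdot0r x : fdot x 0 = 0.
Proof. by rewrite -(scale0r 0) fdotZr mul0r. Qed.

Lemma fdotZl c x y : fdot (c *: x) y = c^* * fdot x y.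
Proof. by rewrite fdotC fdotZr rmorphM /= -fdotC. Qed.

Lemma fdotBl x y z : fdot (x - y) z = fdot x z - fdot y z.
Proof. by rewrite fdotC fdotBr rmorphB /= -!fdotC. Qed.

Lemma fdot_sumr (K : finType) x (F : K -> fock R m) :
  fdot x (\sum_k F k) = \sum_k fdot x (F k).
Proof.
by elim/big_ind2: _ => [|? ? ? ? <- <-|//]; [exact: fdot0r|rewrite fdotDr].
Qed.

Lemma fdot_suml (K : finType) x (F : K -> fock R m) :
  fdot (\sum_k F k) x = \sum_k fdot (F k) x.
Proof.
rewrite fdotC fdot_sumr rmorph_sum.
by apply: eq_bigr => k _; rewrite [RHS]fdotC.
Qed.

Lemma fdot_ge0 x : 0 <= fdot x x.
Proof. by apply: sumr_ge0 => I _; rewrite mulrC mul_conjC_ge0. Qed.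

Lemma fdot_eq0 x : fdot x x = 0 -> x = 0.
Proof.
move=> /eqP; rewrite psumr_eq0 => [/allP x0|I _]; last first.
  by rewrite mulrC mul_conjC_ge0.
apply/ffunP => I; rewrite ffunE; have := x0 I (mem_index_enum I).
by rewrite /= mulf_eq0 conjC_eq0 orbb => /eqP.
Qed.

Lemma overlapE x y : (overlap x y)%:C = `|fdot x y|.
Proof. by rewrite /overlap RRe_real ?normr_real. Qed.

Lemma overlap_ge0 x y : 0 <= overlap x y.
Proof. by rewrite -ler0c overlapE. Qed.

Lemma sqr_overlapE x y : (overlap x y ^+ 2)%:C = (fdot x y)^* * fdot x y.
Proof. by rewrite rmorphXn /= overlapE normCK mulrC. Qed.

(** For x nonzero, the squared norm of <x|x> y - <x|y> x equals <x|x> times the difference of the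
    two sides. *)
Lemma fdot_CauchySchwarz x y : `|fdot x y| ^+ 2 <= fdot x x * fdot y y.
Proof.
have [x0|x0] := eqVneq (fdot x x) 0.
  rewrite (fdot_eq0 _ x0) (_ : fdot 0 y = 0).
    by rewrite normr0 expr0n mulr_ge0 ?fdot_ge0.
  by rewrite fdotC fdot0r conjC0.
have xgt0 : 0 < fdot x x by rewrite lt_def x0 fdot_ge0.
rewrite -subr_ge0 -(pmulr_rge0 _ xgt0).
have := fdot_ge0 (fdot x x *: y - fdot x y *: x); congr (0 <= _).
rewrite fdotBl !fdotBr !fdotZl !fdotZr normCK -!fdotC (fdotC x y).
by ring.
Qed.

(** Both vectors are split into their projection [p] on the span of the [e k] and a remainder;
    Cauchy-Schwarz for the remainders gives the square root. *)
Lemma bessel_overlap (K : finType) (e : K -> fock R m) x y :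
  (forall k l, fdot (e k) (e l) = (k == l)%:R) ->
  fdot x x = 1 -> fdot y y = 1 ->
  [/\ \sum_k overlap (e k) x ^+ 2 <= 1, \sum_k overlap (e k) y ^+ 2 <= 1 &
  overlap x y <= \sum_k overlap (e k) x * overlap (e k) y +
    Num.sqrt ((1 - \sum_k overlap (e k) x ^+ 2) *
              (1 - \sum_k overlap (e k) y ^+ 2))].
Proof.
move=> eO x1 y1.
pose p z := \sum_k fdot (e k) z *: e k.
have ep k z : fdot (e k) (p z) = fdot (e k) z.
  rewrite fdot_sumr (bigD1 k) //= fdotZr eO eqxx mulr1 big1 ?addr0 // => l lk.
  by rewrite fdotZr eO eq_sym (negPf lk) mulr0.
have pl z t : fdot (p z) t = \sum_k (fdot (e k) z)^* * fdot (e k) t.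
  by rewrite fdot_suml; apply: eq_bigr => k _; rewrite fdotZl.
have pr z t : fdot z (p t) = \sum_k (fdot (e k) z)^* * fdot (e k) t.
  by rewrite fdot_sumr; apply: eq_bigr => k _; rewrite fdotZr -fdotC mulrC.
have q z t : fdot (z - p z) (t - p t) =
    fdot z t - \sum_k (fdot (e k) z)^* * fdot (e k) t.
  rewrite fdotBl !fdotBr pr !pl.
  under [X in _ - (_ - X)]eq_bigr do rewrite ep.
  by rewrite subrr subr0.
have q1 z : fdot z z = 1 -> fdot (z - p z) (z - p z) =
    (1 - \sum_k overlap (e k) z ^+ 2)%:C.
  move=> z1; rewrite q z1 rmorphB rmorph1 rmorph_sum /=; congr (_ - _).
  by apply: eq_bigr => k _; rewrite sqr_overlapE.
have le1 z : fdot z z = 1 -> \sum_k overlap (e k) z ^+ 2 <= 1.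
  by move=> z1; rewrite -subr_ge0 -ler0c -q1 // fdot_ge0.
split; [exact: le1|exact: le1|].
have xyE : fdot x y = \sum_k (fdot (e k) x)^* * fdot (e k) y +
    fdot (x - p x) (y - p y) by rewrite q addrC subrK.
rewrite -lecR overlapE xyE (le_trans (ler_normD _ _)) // rmorphD /= lerD //.
  rewrite rmorph_sum /= (le_trans (ler_norm_sum _ _ _)) // ler_sum // => k _.
  by rewrite normrM norm_conjC rmorphM /= !overlapE.
rewrite -overlapE lecR -[leLHS]ger0_norm ?overlap_ge0 // -sqrtr_sqr.
rewrite ler_wsqrtr // -lecR rmorphXn rmorphM /= overlapE -!q1 //.
exact: fdot_CauchySchwarz.
Qed.

End FockForm.

(** * Anticommutation, contraction of wedge products and Gram determinants *)

Section FockAlgebra.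
Variables (R : realType) (m : nat).
Local Notation C := (R[i]).
Implicit Types (x y z : fock R m) (v w : 'rV[C]_m) (I : {set 'I_m}).

Let below I (i : 'I_m) := #|[set j in I | (j < i)%N]%SET|.

Let below_setD1 I (i k : 'I_m) : i \in I ->
  below I k = ((i < k) + below (I :\ i)%SET k)%N.
Proof.
move=> iI; rewrite /below (cardsD1 i) inE iI /=; congr (_ + _)%N.
by apply: eq_card => j; rewrite !inE andbA.
Qed.

Lemma creationZ v c x : creation v (c *: x) = c *: creation v x.
Proof.
apply/ffunP => I; rewrite !ffunE /GRing.scale /= mulr_sumr.
by apply: eq_bigr => i _; rewrite ffunE /GRing.scale /=; ring.
Qed.

Lemma creation_sumr (K : finType) v (F : K -> fock R m) :
  creation v (\sum_k F k) = \sum_k creation v (F k).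
Proof.
apply/ffunP => I; rewrite sum_ffunE ffunE.
under [RHS]eq_bigr do rewrite ffunE.
by rewrite exchange_big /=; apply: eq_bigr => i _; rewrite sum_ffunE mulr_sumr.
Qed.

(** Only the basis vector of [i |: I] contributes to the adjoint, and the sign is unchanged because
    i is not below itself. *)
Lemma annihilationE v x I : annihilation v x I =
  \sum_(i | i \notin I)
     (-1) ^+ #|[set j in I | (j < i)%N]%SET| * (v 0 i)^* * x (i |: I)%SET.
Proof.
rewrite ffunE /fdot.
under eq_bigr do rewrite ffunE rmorph_sum mulr_suml.
rewrite (exchange_big_dep predT) //= [LHS](bigID (fun i => i \in I)) /=.
rewrite big1 ?add0r => [|i iI].
  apply: eq_bigr => i iI; rewrite (bigD1 (i |: I)%SET) /=; last first.
    exact: finset.setU11.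
  rewrite ffunE finset.setU1K // eqxx mulr1 rmorphM rmorphXn rmorphN1 /=.
  rewrite -/(below _ _) (below_setD1 _ i) ?finset.setU11 // finset.setU1K //.
  rewrite ltnn.
  rewrite big1 ?addr0 // => J /andP[iJ JI].
  rewrite ffunE (_ : (J :\ i == I)%SET = false) ?mulr0 ?rmorph0 ?mul0r //.
  by apply: contraNF JI => /eqP <-; rewrite finset.setD1K.
apply: big1 => J iJ; rewrite ffunE (_ : (J :\ i == I)%SET = false).
  by rewrite mulr0 rmorph0 mul0r.
by apply: contraTF iI => /eqP <-; rewrite !inE eqxx.
Qed.

Lemma annihilationZ v c x : annihilation v (c *: x) = c *: annihilation v x.
Proof. by apply/ffunP => I; rewrite !ffunE fdotZr. Qed.

(** The canonical anticommutation relation. Indices outside [I] give the diagonal terms of one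
    product and indices in [I] those of the other; together they form the inner product, while the
    cross terms cancel. *)
Lemma annihilation_creation v w x :
  annihilation v (creation w x) =
  (w *m v^t*) 0 0 *: x - creation w (annihilation v x).
Proof.
apply/eqP; rewrite -subr_eq0 opprB addrA subr_eq0; apply/eqP.
apply/ffunP => I; rewrite ffunE annihilationE.
rewrite [creation w (annihilation _ _) _]ffunE.
rewrite [RHS]ffunE /GRing.scale /= mxE mulr_suml.
under eq_bigr => i iI.
  rewrite ffunE big_setU1 //= -/(below I i) -/(below _ i) finset.setU1K //.
  rewrite (below_setD1 (i |: I)%SET i) ?finset.setU11 // finset.setU1K //.
  rewrite ltnn mulrDr.
  rewrite (_ : _ * _ * (_ * x I) = w 0 i * (v 0 i)^* * x I); last first.
    by rewrite add0n -[RHS]mul1r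
      -[X in _ = X * _](sqrr_sign C (below I i)); ring.
  rewrite mulr_sumr.
  over.
under [X in _ + X]eq_bigr => k kI.
  rewrite annihilationE (bigD1 k) /=; last by rewrite !inE eqxx.
  rewrite finset.setD1K // -/(below I k) -/(below _ k) (below_setD1 _ k k) //.
  rewrite ltnn mulrDr.
  rewrite (_ : _ * _ * (_ * x I) = w 0 k * (v 0 k)^* * x I); last first.
    by rewrite add0n -[RHS]mul1r
      -[X in _ = X * _](sqrr_sign C (below (I :\ k)%SET k)); ring.
  rewrite (eq_bigl (fun i => i \notin I)); last first.
    move=> i; rewrite !inE.
    by case: eqVneq => [->|_]; rewrite ?kI ?andbF ?andbT.
  rewrite mulr_sumr.
  over.
rewrite !big_split /= addrACA [X in _ + X](_ : _ = 0).
  rewrite addr0 [RHS](bigID (fun i => i \in I)) /= addrC; congr (_ + _).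
  1,2: by apply: eq_bigr => i _; rewrite !mxE.
rewrite [X in X + _]exchange_big /= -big_split big1 //= => k kI.
rewrite -big_split big1 //= => i iI.
have ik : i != k by apply: contraNneq iI => ->.
have -> : ((i |: I) :\ k = i |: (I :\ k))%SET.
  apply/finset.setP => j; rewrite !inE.
  by case: (eqVneq j i) => [->|]; rewrite ?ik.
rewrite -!/(below _ _) (below_setD1 I k i) //.
rewrite (below_setD1 (i |: I)%SET i k) ?finset.setU11 // finset.setU1K //.
rewrite (below_setD1 I k k) //.
rewrite ltnn add0n.
(* Exactly one of the two orders of i and k adds a transposition sign, so the two cross terms are
   opposite. *)
have : (i < k)%N (+) (k < i)%N.
  by case: ltngtP ik => // /val_inj ->; rewrite eqxx.
rewrite !exprD; case: (i < k)%N (k < i)%N => [] [] //= _.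
all: by rewrite ?expr1 ?expr0; ring.
Qed.

Lemma annihilation_vacuum v : annihilation v (vacuum R m) = 0.
Proof.
apply/ffunP => I; rewrite annihilationE ffunE big1 // => i _.
rewrite ffunE (_ : (_ == _) = false) ?mulr0 //.
by apply/eqP => /finset.setP/(_ i); rewrite !inE eqxx.
Qed.

Lemma wedge_rec n (phi : orbitals R n.+1 m) :
  wedge phi = creation (row 0 phi) (wedge (row' 0 phi)).
Proof.
rewrite /wedge enum_ordSl /=; congr (creation _ _).
rewrite foldr_map; elim: (enum 'I_n) => //= i s ->; congr (creation _ _).
by apply/rowP => j; rewrite !mxE.
Qed.

(** The annihilator moves past one creator at a time, each time leaving an inner product and
    changing sign, until it kills the vacuum. *)
Lemma annihilation_wedge n v (phi : orbitals R n m) :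
  annihilation v (wedge phi) =
  \sum_(nu < n) ((-1) ^+ nu * (phi *m v^t*) nu 0) *: wedge (row' nu phi).
Proof.
elim: n phi => [|n IH] phi.
  by rewrite big_ord0 /wedge enum_ord0 annihilation_vacuum.
rewrite [in LHS]wedge_rec annihilation_creation IH big_ord_recl.
rewrite expr0 mul1r -row_mul mxE; congr (_ + _).
rewrite creation_sumr -sumrN; apply: eq_bigr => nu _.
rewrite creationZ -scaleNr.
rewrite (_ : (row' 0 phi *m v^t*) nu 0 = (phi *m v^t*) (lift ord0 nu) 0).
  rewrite lift0 exprS mulN1r mulNr; congr (_ *: _).
  (* A further row is needed to peel row 0 off [row' (lift ord0 nu) phi]; without it there is no
     [nu]. *)
  case: n phi nu {IH} => [|n] phi nu; first by case: nu.
  rewrite [RHS]wedge_rec; congr (creation _ _).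
    apply/rowP => j; rewrite !mxE; congr (phi _ _); exact/val_inj.
  congr (@wedge R m n _).
  apply/matrixP => i j; rewrite !mxE; congr (phi _ _); apply/val_inj => /=.
  by rewrite /bump; lia.
by rewrite !mxE; apply: eq_bigr => j _; rewrite !mxE.
Qed.

(** Moving the first creator of [wedge g] to the other side and contracting reproduces the Laplace
    expansion along column 0. *)
Lemma fdot_wedge n (g phi : orbitals R n m) :
  fdot (wedge g) (wedge phi) = \det (phi *m g^t*).
Proof.
elim: n g phi => [|n IH] g phi.
  rewrite det_mx00 /wedge enum_ord0 /= /fdot (bigD1 finset.set0) //=.
  rewrite !ffunE eqxx rmorph1 mulr1 big1 ?addr0 // => I /negPf I0.
  by rewrite !ffunE I0 mulr0.
rewrite [wedge g]wedge_rec annihilation_adjoint annihilation_wedge fdot_sumr.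
rewrite (expand_det_col _ 0); apply: eq_bigr => nu _.
rewrite fdotZr IH /cofactor addn0 mulrAC [RHS]mulrC -!mulrA.
congr (_ * (_ * _)).
  congr (\det _); apply/matrixP => i j; rewrite !mxE.
  by apply: eq_bigr => k _; rewrite !mxE.
by rewrite !mxE; apply: eq_bigr => k _; rewrite !mxE.
Qed.

(** * Particle-hole excitations: orthonormality and overlaps with Slater determinants *)

Section Excitations.
Variables (n k : nat) (g : orbitals R n m) (f : orbitals R k m).
Hypotheses (g_on : g \is unitarymx) (f_on : f \is unitarymx).
Hypothesis (gf : g *m f^t* = 0).

Lemma fdot_wedge_unitary : fdot (wedge g) (wedge g) = 1.
Proof. by rewrite fdot_wedge (unitarymxP g_on) det1. Qed.

Lemma annihilation_occupied mu :
  annihilation (row mu g) (wedge g) = (-1) ^+ mu *: wedge (row' mu g).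
Proof.
have E nu : (g *m (row mu g)^t*) nu 0 = (nu == mu)%:R.
  have <- : (g *m g^t*) nu mu = (nu == mu)%:R by rewrite (unitarymxP g_on) mxE.
  by rewrite !mxE; apply: eq_bigr => j _; rewrite !mxE.
rewrite annihilation_wedge (bigD1 mu) //= E eqxx mulr1 big1 ?addr0 //.
by move=> nu /negPf numu; rewrite E numu mulr0 scale0r.
Qed.

Lemma fdot_minor (h phi : orbitals R n m) (mu nu : 'I_n) :
  (-1) ^+ (nu + mu) * fdot (wedge (row' mu h)) (wedge (row' nu phi)) =
  cofactor (phi *m h^t*) nu mu.
Proof.
rewrite fdot_wedge; congr (_ * \det _); apply/matrixP => i j; rewrite !mxE.
by apply: eq_bigr => l _; rewrite !mxE.
Qed.

(** Removing [g_mu] from [wedge g] and one orbital from [wedge phi] leaves a minor of A; the two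
    signs turn it into a cofactor, whence adj(A) B. *)
Lemma fdot_excitation (phi : orbitals R n m) a mu :
  fdot (excitation g f a mu) (wedge phi) =
  (\adj (phi *m g^t*) *m (phi *m f^t*)) mu a.
Proof.
rewrite annihilation_adjoint annihilation_occupied annihilation_wedge fdot_sumr.
rewrite mxE; apply: eq_bigr => nu _; rewrite fdotZr fdotZl rmorphXn rmorphN1.
rewrite [in RHS]mxE -fdot_minor exprD.
rewrite (_ : (phi *m (row a f)^t*) nu 0 = (phi *m f^t*) nu a); last first.
  by rewrite !mxE; apply: eq_bigr => j _; rewrite !mxE.
by rewrite /=; ring.
Qed.

Lemma excitation_orthogonal a mu : fdot (excitation g f a mu) (wedge g) = 0.
Proof. by rewrite fdot_excitation gf mulmx0 mxE. Qed.

(** Anticommuting the two unoccupied orbitals yields [a == b], since the annihilator of [f_a] kills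
    what is built from rows of [g]; what remains is a cofactor of the identity. *)
Lemma excitation_orthonormal a b mu nu :
  fdot (excitation g f a mu) (excitation g f b nu) =
  ((a == b) && (mu == nu))%:R.
Proof.
rewrite annihilation_adjoint annihilation_creation !annihilation_occupied.
have E : annihilation (row a f) ((-1) ^+ nu *: wedge (row' nu g)) = 0.
  rewrite annihilationZ annihilation_wedge big1 ?scaler0 // => l _.
  rewrite (_ : (_ *m _) l 0 = (g *m f^t*) (lift nu l) a).
    by rewrite gf mxE mulr0 scale0r.
  by rewrite !mxE; apply: eq_bigr => j _; rewrite !mxE.
rewrite E -(scale0r 0) creationZ scale0r subr0 !fdotZr fdotZl rmorphXn rmorphN1.
rewrite (_ : (_ *m _) 0 0 = (a == b)%:R); last first.
  have <- : (f *m f^t*) b a = (a == b)%:R.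
    by rewrite (unitarymxP f_on) mxE eq_sym.
  by rewrite !mxE; apply: eq_bigr => j _; rewrite !mxE.
rewrite [X in _ * X](_ : _ = (mu == nu)%:R); first by rewrite -natrM mulnb.
rewrite mulrA -exprD fdot_minor (unitarymxP g_on).
have := congr1 (fun M : 'M[C]_n => M mu nu) (adj1 C n).
by rewrite !mxE.
Qed.

End Excitations.

End FockAlgebra.

(** * Matrix analysis leading to inequality (1) *)

(** Since n + k = m, stacking [g] on [f] gives a square matrix, whose right inverse is also a left
    inverse. *)
Lemma unitary_resolution (C : numClosedFieldType) (n k m : nat)
    (g : 'M[C]_(n, m)) (f : 'M[C]_(k, m)) : (n + k)%N = m ->
  g \is unitarymx -> f \is unitarymx -> g *m f^t* = 0 ->
  g^t* *m g + f^t* *m f = 1%:M.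
Proof.
move=> nk; case: m / nk g f => g f /unitarymxP gg /unitarymxP ff gf.
have fg : f *m g^t* = 0.
  by rewrite -[f]trmxCK -map_mxM -trmx_mul gf trmx0 map_mx0.
have U : col_mx g f *m row_mx (g^t*) (f^t*) = 1%:M.
  by rewrite mul_col_row gg ff gf fg -scalar_mx_block.
by have := mulmx1C U; rewrite mul_row_col.
Qed.

(** Induction on the factors, with the bound D >= 1 carried along; the induction step rests on e + 1
    >= 2 and E^2 + 1 >= 2 E. *)
Lemma prod_ge1_le_sum_sqr (R : realFieldType) (K : finType) (s : K -> R) :
  (forall k, 1 <= s k) ->
  1 <= \prod_k s k /\
  (\prod_k s k - 1) * (3 - \prod_k s k) <= \sum_k (s k ^+ 2 - 1).
Proof.
move=> s1; elim/big_rec2: _ => [|k D E _ [E1 ED]].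
  by split; rewrite ?subrr ?mul0r.
have := s1 k; move: (s k) => e e1; split; first by nra.
(* By this much the gap between the two sides grows when e joins E. *)
have : 0 <= (e - 1) * ((e + 1) * (E ^+ 2 + 1) - 4 * E).
  by apply: mulr_ge0; [lra|nra].
by nra.
Qed.

Lemma mulmx_conjtr_diag (C : numClosedFieldType) n k (T : 'M[C]_(n, k)) i :
  (T *m T^t*) i i = \sum_j `|T i j| ^+ 2.
Proof. by rewrite mxE; apply: eq_bigr => j _; rewrite !mxE normCK. Qed.

(** The q_i are the eigenvalues of T T^H, whose trace is the squared Frobenius norm of T. *)
Lemma gram_psd_spectrum (C : numClosedFieldType) n k (T : 'M[C]_(n, k)) :
  exists q : 'I_n -> C, [/\ forall i, 0 <= q i,
    \sum_i q i = \sum_i \sum_j `|T i j| ^+ 2 &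
    \prod_i (1 + q i) = \det (1%:M + T *m T^t*)].
Proof.
pose Q := T *m T^t*; pose P := spectralmx Q.
have Pu : P \is unitarymx by exact: spectral_unitarymx.
have PU : P \in unitmx by exact: spectral_unit.
have QE : Q = invmx P *m diag_mx (spectral_diag Q) *m P.
  apply/orthomx_spectralP/normalmxP.
  by rewrite /Q trmx_mul map_mxM -/(_^t*) trmxCK.
exists (spectral_diag Q 0); split=> [i||].
(* In the eigenbasis each eigenvalue is a diagonal entry of a Gram matrix, hence a sum of squared
   moduli. *)
- have : (P *m T *m (P *m T)^t*) i i = spectral_diag Q 0 i.
    rewrite trmx_mul map_mxM -!mulmxA (mulmxA T) -/Q [in LHS]QE.
    rewrite -invmx_unitary //.
    by rewrite !mulmxA mulmxV // mul1mx mulmxK // mxE eqxx.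
  by rewrite mulmx_conjtr_diag => <-; apply: sumr_ge0 => j _; rewrite exprn_ge0.
- transitivity (\tr Q).
    by rewrite [in RHS]QE mxtrace_mulC mulmxA mulmxV // mul1mx mxtrace_diag.
  by apply: eq_bigr => i _; rewrite mulmx_conjtr_diag.
- rewrite -/Q (_ : 1%:M + Q =
      invmx P *m diag_mx (\row_i (1 + spectral_diag Q 0 i)) *m P).
    rewrite !det_mulmx mulrAC -det_mulmx mulVmx // det1 mul1r det_diag.
    by apply: eq_bigr => i _; rewrite mxE.
  rewrite [in LHS]QE -[in LHS](mulVmx PU) -[X in X *m P + _]mulmx1 -mulmxDl.
  rewrite -mulmxDr; congr (_ *m _ *m _).
  by apply/matrixP => i j; rewrite !mxE; case: eqP; rewrite ?addr0.
Qed.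

(** This is (1), because 1 - c^2 - 2 (1 - c)^2 = (1 - c) (3 c - 1). *)
Lemma adj_mulmx_norm_ge (R : realType) n k
    (A : 'M[R[i]]_n) (B : 'M[R[i]]_(n, k)) (c : R) :
  A *m A^t* + B *m B^t* = 1%:M -> c%:C = `|\det A| ->
  ((1 - c) * (3 * c - 1))%:C <= \sum_i \sum_j `|(\adj A *m B) i j| ^+ 2.
Proof.
move=> AB cE; have [A0|A0] := eqVneq (\det A) 0.
  (* For singular A the left side is -1. *)
  have -> : c = 0 by apply: complexI; rewrite cE A0 normr0.
  rewrite mulr0 sub0r subr0 mul1r rmorphN1.
  apply: (@le_trans _ _ 0); first by rewrite lerN10.
  by apply: sumr_ge0 => i _; apply: sumr_ge0 => j _; rewrite exprn_ge0.
have AU : A \in unitmx by rewrite unitmxE unitfE.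
have c0 : 0 < c by rewrite -ltcR cE normr_gt0.
pose T := invmx A *m B.
have adjE : \adj A *m B = \det A *: T.
  by rewrite /T /invmx AU -scalemxAl scalerA divff // scale1r.
have [q [q0 qT qD]] := gram_psd_spectrum _ _ _ T.
have detT : \det (1%:M + T *m T^t*) = (c^-1 ^+ 2)%:C.
  (* Multiply A A^H + B B^H = 1 by A^{-1} on the left and its adjoint on the right. *)
  rewrite (_ : 1%:M + _ = invmx A *m (invmx A)^t*).
    rewrite det_mulmx det_map_mx det_tr det_inv -normCK normfV -cE.
    by rewrite -fmorphV -rmorphXn.
  rewrite -[X in _ = X *m _]mulmx1 -[in RHS]AB mulmxDr mulmxDl mulmxA.
  rewrite mulVmx // mul1mx.
  congr (_ + _); last by rewrite /T trmx_mul map_mxM !mulmxA.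
  by rewrite -map_mxM -trmx_mul mulVmx // trmx1 map_mx1.
pose r i := complex.Re (q i).
have rE i : (r i)%:C = q i by rewrite /r RRe_real ?ger0_real.
have r0 i : 0 <= r i by rewrite -ler0c rE.
pose s i := Num.sqrt (1 + r i).
have s2 i : s i ^+ 2 = 1 + r i by rewrite sqr_sqrtr // addr_ge0.
have s1 i : 1 <= s i by rewrite -[leLHS]sqrtr1 ler_wsqrtr // lerDl.
have [D1] := prod_ge1_le_sum_sqr _ _ _ s1.
have -> : \prod_i s i = c^-1.
  apply/eqP; rewrite -(@eqrXn2 _ 2) ?invr_ge0 ?(ltW c0) ?(le_trans _ D1) //.
  rewrite -prodrXl; apply/eqP/complexI; rewrite -detT -qD rmorph_prod.
  by apply: eq_bigr => i _; rewrite s2 rmorphD rmorph1 /= rE.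
under eq_bigr do rewrite s2 addrC addKr.
move=> DS; under eq_bigr do under eq_bigr do rewrite adjE mxE normrM exprMn -cE.
under eq_bigr do rewrite -mulr_sumr.
rewrite -mulr_sumr -qT; under eq_bigr do rewrite -rE.
rewrite -rmorph_sum -rmorphXn -rmorphM lecR.
(* With D = 1/c, c^2 (D - 1) (3 - D) is exactly (1 - c) (3 c - 1). *)
apply: le_trans (ler_wpM2l (sqr_ge0 c) DS).
by rewrite le_eqVlt; apply/orP; left; apply/eqP; field; rewrite gt_eqF.
Qed.

(** The hypothesis says 2 (1 - a^2) < a^2; take square roots. *)
Lemma sub_sqrt_gt0 (R : rcfType) (a : R) : 0 <= a -> 2 / 3 < a ^+ 2 ->
  0 < a - Num.sqrt 2 * Num.sqrt (1 - a ^+ 2).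
Proof.
move=> a0 a23; have a2 : 0 < a ^+ 2 by lra.
have lt : 2 * (1 - a ^+ 2) < a ^+ 2 by lra.
by rewrite subr_gt0 -sqrtrM // -[ltRHS]ger0_norm // -sqrtr_sqr ltr_sqrt.
Qed.

(** * The overlap of an arbitrary Slater determinant with [psi] *)

Section SlaterBound.
Variables (R : realType) (m n k : nat) (psi : fock R m).
Variables (g : orbitals R n m) (f : orbitals R k m).
Hypotheses (nk : (n + k)%N = m) (psi1 : fdot psi psi = 1).
Hypotheses (g_on : g \is unitarymx) (f_onb : onb_complement g f).
Let G := wedge g.
Let alpha := overlap G psi.
Let kappa := alpha - Num.sqrt 2 * Num.sqrt (1 - alpha ^+ 2).
Hypothesis alpha_gt : 2 / 3 < alpha ^+ 2.

Lemma onb_complement_ortho : g *m f^t* = 0.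
Proof.
have [_ fE] := f_onb; have /orthomx1P fg : (f <= orthomx Num.conj
    (mx_of_hermitian (hermitian1mx _)) g)%MS by rewrite fE.
by rewrite -[g]trmxCK -map_mxM -trmx_mul fg trmx0 map_mx0.
Qed.

Lemma overlap_wedge_le1 : alpha ^+ 2 <= 1.
Proof.
have := fdot_CauchySchwarz _ _ G psi.
rewrite fdot_wedge_unitary // psi1 mulr1 -overlapE.
by rewrite -rmorphXn -[X in _ <= X]/(1%:C) lecR.
Qed.

Lemma kappa_gt0 : 0 < kappa.
Proof. by apply: sub_sqrt_gt0 => //; exact: overlap_ge0. Qed.

(** The quadratic term on the left is kept for uniqueness: it measures how far [wedge phi] is from
    [G] up to phase. *)
Lemma overlap_slater_le (phi : orbitals R n m) : phi \is unitarymx ->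
  overlap G (wedge phi) <= 1 /\
  overlap (wedge phi) psi + kappa * (1 - overlap G (wedge phi)) ^+ 2 / 2 <=
    alpha + brillouin g f psi ^+ 2 / (2 * kappa).
Proof.
move=> phi_on; set S := wedge phi; have gf := onb_complement_ortho.
have [f_on _] := f_onb.
(* [None] indexes [G], so that Bessel applies to [G] and its excitations as one orthonormal
   family. *)
pose e (o : option ('I_k * 'I_n)) :=
  if o is Some (a, mu) then excitation g f a mu else G.
have eO p q : fdot (e p) (e q) = (p == q)%:R.
  case: p q => [[a mu]|] [[b nu]|] /=.
  - by rewrite excitation_orthonormal.
  - by rewrite excitation_orthogonal.
  - by rewrite fdotC excitation_orthogonal // conjC0.
  - by rewrite fdot_wedge_unitary.
have sumO (F : option ('I_k * 'I_n) -> R) :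
    \sum_o F o = F None + \sum_a \sum_mu F (Some (a, mu)).
  rewrite (bigD1 None) //= (reindex_omap Some id) /=; last by case.
  rewrite pair_big /=; congr (_ + _).
  by apply: eq_big => [p|[a mu]]; rewrite ?eqxx.
have S1 : fdot S S = 1 by rewrite fdot_wedge_unitary.
have [] := bessel_overlap _ _ _ e S psi eO S1 psi1.
rewrite !sumO /= -/G -/alpha; set c := overlap G S.
set st := \sum_a _; set su := \sum_a _; set tu := \sum_a _.
have -> : brillouin g f psi ^+ 2 = su.
  rewrite sqr_sqrtr // sumr_ge0 // => a _; apply: sumr_ge0 => mu _.
  exact: sqr_ge0.
have st0 : 0 <= st.
  rewrite sumr_ge0 // => a _; apply: sumr_ge0 => mu _.
  exact: sqr_ge0.
have su0 : 0 <= su.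
  rewrite sumr_ge0 // => a _; apply: sumr_ge0 => mu _.
  exact: sqr_ge0.
have c0 : 0 <= c by exact: overlap_ge0.
have a0 : 0 <= alpha by exact: overlap_ge0.
have k0 := kappa_gt0.
have a1 := overlap_wedge_le1.
move=> stc sua le; have c1 : c <= 1 by nra.
(* Each product t u is bounded by u^2 / (2 kappa) + kappa t^2 / 2; under the square root, (1) bounds
   one factor and [su] is dropped from the other. *)
split=> //; apply: le_trans (_ : _ <= c * alpha + (su / (2 * kappa) +
   kappa * st / 2) + Num.sqrt 2 * Num.sqrt (1 - alpha ^+ 2) * (1 - c) +
   kappa * (1 - c) ^+ 2 / 2) _.
  rewrite lerD2r (le_trans le) // lerD //.
    rewrite lerD2l /tu /su /st mulr_suml mulr_sumr mulr_suml -big_split.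
    apply: ler_sum => a _; rewrite mulr_suml mulr_sumr mulr_suml -big_split.
    apply: ler_sum => mu _ /=; rewrite -subr_ge0.
    set t := overlap _ S; set u := overlap _ psi.
    rewrite (_ : _ - _ = (u - kappa * t) ^+ 2 / (2 * kappa)).
      by rewrite divr_ge0 ?sqr_ge0 ?mulr_ge0 ?ltW.
    by field; rewrite gt_eqF.
  have b0 : 0 <= Num.sqrt 2 * Num.sqrt (1 - alpha ^+ 2) * (1 - c).
    by rewrite !mulr_ge0 ?sqrtr_ge0 ?subr_ge0.
  rewrite -[leRHS]ger0_norm // -sqrtr_sqr ler_wsqrtr // !exprMn.
  rewrite !sqr_sqrtr ?subr_ge0 //.
  have key : (1 - c) * (3 * c - 1) <= st.
    have cE : c%:C = `|\det (phi *m g^t*)| by rewrite overlapE fdot_wedge.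
    have AB : (phi *m g^t*) *m (phi *m g^t*)^t* +
        (phi *m f^t*) *m (phi *m f^t*)^t* = 1%:M.
      rewrite !trmx_mul !map_mxM !trmxCK !mulmxA -mulmxDl -!mulmxA -mulmxDr.
      by rewrite unitary_resolution // mulmx1 (unitarymxP phi_on).
    rewrite -lecR (le_trans (adj_mulmx_norm_ge _ _ _ _ _ _ AB cE)) // le_eqVlt.
    apply/orP; left; apply/eqP; rewrite exchange_big rmorph_sum.
    apply: eq_bigr => a _; rewrite rmorph_sum; apply: eq_bigr => mu _.
    by rewrite /= rmorphXn /= overlapE fdot_excitation.
  apply: (@le_trans _ _ ((1 - (c ^+ 2 + st)) * (1 - alpha ^+ 2))).
    by apply: ler_wpM2l; lra.
  rewrite mulrAC; apply: ler_wpM2r; lra.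
(* Replacing [st] by 1 - c^2, the two [kappa] terms add up to kappa (1 - c); as kappa + b = alpha,
   the total is alpha + su / (2 kappa). *)
have : 0 <= kappa * (1 - c ^+ 2 - st) by apply: mulr_ge0; [exact: ltW|lra].
have : kappa = alpha - Num.sqrt 2 * Num.sqrt (1 - alpha ^+ 2) by [].
move: (Num.sqrt 2 * _) (su / _) => b s; nra.
Qed.

End SlaterBound.

Theorem theorem5 (R : realType) (m n : nat) (hnm : (n <= m)%N)
    (psi : fock R m) (psi_n : sector n psi) (psi1 : fdot psi psi = 1)
    (g : orbitals R n m) (g_on : g \is unitarymx)
    (f : orbitals R (m - n) m) (f_onb : onb_complement g f) :
  let G := wedge g in
  let alpha := overlap G psi in
  let kappa := alpha - Num.sqrt 2 * Num.sqrt (1 - alpha ^+ 2) in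
  let B := brillouin g f psi in
  overlap G psi ^+ 2 > 2 / 3 ->
  (forall OPT : R, is_max (fidelities n psi) OPT ->
     OPT <= (overlap G psi + B ^+ 2 / (2 * kappa)) ^+ 2) /\
  (B = 0 ->
     closest_slater n psi G /\
     forall S : fock R m, closest_slater n psi S ->
       exists c : R[i], `|c| = 1 /\ S = c *: G).
Proof.
move=> G alpha kappa B alpha_gt.
have nk : (n + (m - n))%N = m by rewrite subnKC.
have k0 : 0 < kappa by exact: kappa_gt0.
have bound := overlap_slater_le _ _ _ _ _ _ _ nk psi1 g_on f_onb alpha_gt.
have le (phi : orbitals R n m) : phi \is unitarymx ->
    overlap (wedge phi) psi <= alpha + B ^+ 2 / (2 * kappa).
  move=> /bound[_]; apply: le_trans; rewrite lerDl.
  by rewrite divr_ge0 // mulr_ge0 ?sqr_ge0 // ltW.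
split=> [OPT [[_ [phi phi_on ->] <-] _]|B0].
  rewrite lerXn2r ?nnegrE ?overlap_ge0 ?le //.
  by rewrite (le_trans _ (le _ phi_on)) ?overlap_ge0.
have le0 (phi : orbitals R n m) :
    phi \is unitarymx -> overlap (wedge phi) psi <= alpha.
  by move=> /le; rewrite B0 expr0n mul0r addr0.
have Gs : slater n G by exists g.
split.
  split=> // _ [phi phi_on ->].
  by rewrite lerXn2r ?nnegrE ?overlap_ge0 ?le0.
move=> _ [[phi phi_on ->] Smax]; set S := wedge phi.
(* [G] is itself a competitor of the maximizer [S]. *)
have aS : alpha <= overlap S psi.
  by rewrite -(@ler_pXn2r _ 2) ?nnegrE ?overlap_ge0 // Smax.
have [c1] := bound _ phi_on.
rewrite -/G -/S -/alpha -/kappa -/B B0 expr0n mul0r addr0.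
(* Together with [aS], this leaves no room for the quadratic term, and [kappa] is positive. *)
move=> cS; have {cS aS c1} c1 : overlap G S = 1.
  have : kappa * (1 - overlap G S) ^+ 2 <= 0 by lra.
  rewrite pmulr_rle0 // => h; apply/eqP; rewrite eq_sym -subr_eq0 -sqrf_eq0.
  by rewrite eq_le h sqr_ge0.
have G1 : fdot G G = 1 by rewrite fdot_wedge_unitary.
have S1 : fdot S S = 1 by rewrite fdot_wedge_unitary.
(* The phase is <G|S>: the squared norm of S - <G|S> G is 1 - |<G|S>|^2 = 0. *)
exists (fdot G S); split; first by rewrite -overlapE c1.
apply/eqP; rewrite -subr_eq0; apply/eqP/fdot_eq0.
rewrite fdotBl !fdotBr !fdotZl !fdotZr G1 S1 mulr1 (fdotC _ _ G S).
rewrite [_ * (_)^*]mulrC -!sqr_overlapE c1 expr1n.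
by rewrite !subrr.
Qed.
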